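(* Let $k\ge 2$ be an integer. For every positive integer $L$, there is a finite simple graph $T$ with the following properties: (i) $T$ admits no signing in which every $2k$-cycle is unbalanced; (ii) the only nonzero dependence among the $2k$-cycles of $T$ is the family of all its $2k$-cycles; (iii) this family (of all $2k$-cycles of $T$) has odd cardinality greater than $L$; (iv) every proper subgraph of $T$ admits a signing in which every $2k$-cycle is unbalanced. In particular, $T\in\mathcal B_{2k}$.
   Context: All graphs are finite and simple. A signing of $G$ is a map $\sigma:E(G)\to\{+1,-1\}$; the sign of a cycle is the product of its edge signs, and the cycle is unbalanced if its sign is $-1$. $\mathcal C_{2k}(G)$ is the set of simple $2k$-cycles of $G$, and $\chi_C\in\mathbb F_2^{E(G)}$ is the edge-incidence vector of $C$. A subfamily (subset) $\mathcal D\subseteq\mathcal C_{2k}(G)$ is a dependence if $\sum_{C\in\mathcal D}\chi_C=0$; it is nonzero if $\mathcal D\neq\varnothing$. $\mathcal A_{2k}$ is the family of graphs that admit a signing in which every $2k$-cycle is unbalanced. $\mathcal B_{2k}$ is the family of graphs that are subgraph-minimal outside $\mathcal A_{2k}$, i.e. graphs not in $\mathcal A_{2k}$ all of whose proper subgraphs are in $\mathcal A_{2k}$. *)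

(* Defs.v *)
From HB Require Import structures.
From mathcomp Require Import all_boot all_order all_algebra.
Set Implicit Arguments. Unset Strict Implicit. Unset Printing Implicit Defensive.
Import GRing.Theory.
Local Open Scope ring_scope.

(* A finite simple graph whose vertex set lies in an ambient finite type U, so
   that the subgraphs of G, including those with fewer vertices, are graphs on
   the same U. *)
Record graph (U : finType) := Graph {
  verts : {set U};
  edges : {set {set U}};
  edgesP : forall e, e \in edges -> (e \subset verts) /\ #|e| = 2%N
}.

Section Graphs.
Variable U : finType.
Implicit Types (G H : graph U) (C : {set {set U}}) (D : {set {set {set U}}}).

Definition edge G := {e : {set U} | e \in edges G}.

Definition adj G : rel U := fun x y => [set x; y] \in edges G.

Definition subgraph H G := (verts H \subset verts G) /\ (edges H \subset edges G).

Definition proper_subgraph H G :=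
  subgraph H G /\ (verts H <> verts G \/ edges H <> edges G).

Definition cycle_edges (s : seq U) : {set {set U}} :=
  [set [set x; next s x] | x in s].

(* A simple n-cycle is identified with its edge set, which determines it when
   n >= 3; the different cyclic orderings of one cycle are counted once. *)
Definition cycles n G : {set {set {set U}}} :=
  [set C | [exists s : n.-tuple U,
              ucycleb (adj G) s && (C == cycle_edges s)]].

Definition signing G (sigma : edge G -> int) :=
  forall e, sigma e = 1 \/ sigma e = -1.

Definition sign G (sigma : edge G -> int) C : int :=
  \prod_(e : edge G | val e \in C) sigma e.

Definition unbalanced G (sigma : edge G -> int) C := sign sigma C = -1.

Definition chi G C : {ffun edge G -> 'F_2} := [ffun e => (val e \in C)%:R].

Definition dependence n G D :=
  D \subset cycles n G /\ \sum_(C in D) chi G C = 0.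

Definition famA n G :=
  exists sigma : edge G -> int,
    signing sigma /\ forall C, C \in cycles n G -> unbalanced sigma C.

Definition famB n G :=
  ~ famA n G /\ forall H, proper_subgraph H G -> famA n H.

End Graphs.

(* Main.v *)
Require Import Defs.
From mathcomp Require Import all_boot all_order all_algebra.
From mathcomp Require Import zify.

(* T is a torus grid C_N x C_N, with N odd and larger than 2k and L, in which
   every horizontal edge is subdivided into k - 1 edges, so that the N^2 faces
   are 2k-cycles. A set of 2k edges with even degrees is too small to wrap around
   the torus: it meets every row and every column of parallel grid edges an even
   number of times, and counting leaves only two horizontal grid edges in one
   column and two vertical ones in one row, which must bound a face. So the
   2k-cycles are the faces. Each edge lies on exactly two faces, hence the only
   nonzero dependence is the family of all faces, of odd size N^2. An odd
   dependence excludes the required signing, and when an edge is removed the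
   remaining faces are linearly independent over F_2, so that signs can be
   prescribed on them. *)

(** * Simple cycles, their dependences over F_2, and signings *)

Section SignedGraphs.
Import GRing.Theory.
Local Open Scope ring_scope.
Set Implicit Arguments. Unset Strict Implicit. Unset Printing Implicit Defensive.

Lemma natr_F2 n : (n%:R == 0 :> 'F_2) = ~~ odd n.
Proof. by rewrite -(dvdn_pcharf (pchar_Fp (isT : prime 2))) dvdn2. Qed.

Lemma F2_bool (x : 'F_2) : x = (x != 0)%:R.
Proof. by apply/eqP; case: x => [[|[|]]]. Qed.

Variable U : finType.
Implicit Types (G H : graph U) (C : {set {set U}}) (D : {set {set {set U}}}).

Lemma cyclesP n G C :
  reflect (exists s : seq U, [/\ size s = n, cycle (adj G) s, uniq s
                               & C = cycle_edges s])
          (C \in cycles n G).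
Proof.
rewrite inE; apply: (iffP existsP) => [[s /andP[/andP[cs us] /eqP Cs]]|].
  by exists s; rewrite size_tuple.
case=> s [/eqP sz cs us Cs]; exists (Tuple sz) => /=.
by rewrite /ucycleb cs us Cs eqxx.
Qed.

(** Once the cycle is rotated to start at [x], its first three entries are distinct, and the third
    is the second successor of [x]. *)
Lemma next_next_neq (s : seq U) x :
  uniq s -> (2 < size s)%N -> x \in s -> next s (next s x) != x.
Proof.
move=> us sz /rot_to[i s' rs].
rewrite -!(next_rot i us); move: us sz; rewrite -(rot_uniq i) -(size_rot i) rs.
case: s' {rs} => [|y [|z s']] //=.
rewrite !inE !negb_or => /and3P[/and3P[xy xz xs] _ _] _.
by rewrite eqxx eqxx [y == x]eq_sym (negPf xy) eq_sym.
Qed.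

(** Two different vertices with the same outgoing edge would be each other's successors, which
    happens only on a cycle of length 2. *)
Lemma cycle_edges_inj (s : seq U) : uniq s -> (2 < size s)%N ->
  {in s &, injective (fun x => [set x; next s x])}.
Proof.
move=> us sz x y xs ys /setP exy; apply/eqP/idPn => nxy.
have := exy x; rewrite !inE eqxx (negPf nxy) /= => /esym/eqP xny.
have := exy y; rewrite !inE eqxx eq_sym (negPf nxy) /= => /eqP ynx.
by have := next_next_neq us sz xs; rewrite -ynx -xny eqxx.
Qed.

Lemma card_cycle_edges (s : seq U) :
  uniq s -> (2 < size s)%N -> #|cycle_edges s| = size s.
Proof.
move=> us sz; rewrite card_in_imset; first exact/card_uniqP.
exact: cycle_edges_inj.
Qed.

Lemma cycle_edges_sub (E : {set {set U}}) (s : seq U) :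
  uniq s -> cycle (fun x y => [set x; y] \in E) s -> cycle_edges s \subset E.
Proof.
move=> us cs; apply/subsetP => _ /imsetP[x xs ->].
exact: (next_cycle cs xs).
Qed.

(* Every vertex of the cycle lies on the edge to its successor and on the edge
   from its predecessor. *)
Lemma cycle_edges_even (s : seq U) x : uniq s -> (2 < size s)%N ->
  ~~ odd #|[set e in cycle_edges s | x \in e]|.
Proof.
move=> us sz.
have [xs|xs] := boolP (x \in s); last first.
  suff -> : [set e in cycle_edges s | x \in e] = set0 by rewrite cards0.
  apply/setP => e; rewrite !inE; apply/negP => /andP[/imsetP[y ys ->]].
  rewrite !inE => /orP[/eqP xy|/eqP xy]; first by rewrite xy ys in xs.
  by rewrite xy mem_next ys in xs.
have xp : x = next s (prev s x) by rewrite next_prev.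
have nxp : x != prev s x.
  apply/eqP => e; have nx : next s x = x by rewrite [in LHS]e -xp.
  by have := next_next_neq us sz xs; rewrite !nx eqxx.
suff -> : [set e in cycle_edges s | x \in e] =
    (fun x => [set x; next s x]) @: [set x; prev s x].
  rewrite card_in_imset ?cards2 ?nxp // => y z yP zP.
  apply: cycle_edges_inj us sz _ _ _ _.
    by case/set2P: yP => ->; rewrite ?mem_prev.
  by case/set2P: zP => ->; rewrite ?mem_prev.
apply/setP => e; rewrite inE; apply/andP/imsetP => [[/imsetP[y ys ->]]|[y]].
  rewrite !inE => /orP[/eqP xy|/eqP xy]; exists y => //; rewrite !inE.
    by rewrite xy eqxx.
  by rewrite [in prev _ _]xy prev_next // eqxx orbT.
move=> yP ->; split.
  by apply: imset_f; case/set2P: yP => ->; rewrite ?mem_prev.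
by case/set2P: yP => ->; rewrite !inE -?xp eqxx ?orbT.
Qed.

Lemma cycles_edges n G C : C \in cycles n G -> C \subset edges G.
Proof. by case/cyclesP=> s [_ cs us ->]; apply: cycle_edges_sub. Qed.

Lemma card_cycles_edges n G C : (2 < n)%N -> C \in cycles n G -> #|C| = n.
Proof.
by move=> n3 /cyclesP[s [sz _ us ->]]; rewrite card_cycle_edges ?sz.
Qed.

Lemma cycles_even n G C x : (2 < n)%N -> C \in cycles n G ->
  ~~ odd #|[set e in C | x \in e]|.
Proof.
by move=> n3 /cyclesP[s [sz _ us ->]]; apply: cycle_edges_even; rewrite ?sz.
Qed.

Lemma cycles_subset n G H : edges H \subset edges G -> cycles n H \subset cycles n G.
Proof.
move=> sHG; apply/subsetP => C /cyclesP[s [sz cs us ->]].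
by apply/cyclesP; exists s; split=> //; apply: sub_cycle cs => x y /(subsetP sHG).
Qed.

Lemma sum_chi G D (e : edge G) :
  (\sum_(C in D) chi G C) e = #|[set C in D | val e \in C]|%:R.
Proof.
rewrite sum_ffunE (eq_bigr (fun C => (val e \in C)%:R)) => [|C _]; last first.
  by rewrite ffunE.
rewrite -natr_sum -sum1_card big_mkcond [in RHS]big_mkcond; congr _%:R.
by apply: eq_bigr => C _; rewrite inE; case: (C \in D); case: (_ \in C).
Qed.

(** The coordinate at [e] of the sum of incidence vectors is the number of members of [D] through
    [e], reduced modulo 2. *)
Lemma dependenceE n G D : dependence n G D <->
  D \subset cycles n G /\
  forall e, e \in edges G -> ~~ odd #|[set C in D | e \in C]|.
Proof.
split=> -[sD]; last move=> dep.
  move=> /ffunP dep; split=> // e eG.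
  by have := dep (exist _ e eG); rewrite sum_chi ffunE => /eqP; rewrite natr_F2.
split=> //; apply/ffunP => e; rewrite sum_chi ffunE; apply/eqP.
by rewrite natr_F2; apply/dep/(valP e).
Qed.

(** The cycles of [H] avoid the edges outside [H], so the additional coordinates vanish. *)
Lemma dependence_subgraph n G H D : edges H \subset edges G ->
  dependence n H D -> dependence n G D.
Proof.
move=> sHG /dependenceE[sD dep]; apply/dependenceE; split.
  exact: subset_trans sD (cycles_subset n sHG).
move=> e _; have [/dep//|eH] := boolP (e \in edges H).
suff -> : [set C in D | e \in C] = set0 by rewrite cards0.
apply/setP => C; rewrite !inE; apply/negP => /andP[/(subsetP sD)/cycles_edges sC].
by move/(subsetP sC); apply/negP.
Qed.

(* The product of the signs of the members of a dependence is a product of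
   squares, hence positive. *)
Lemma odd_dependence_not_famA n G D :
  dependence n G D -> odd #|D| -> ~ famA n G.
Proof.
move=> /dependenceE[sD dep] oD [sigma [sgn unb]].
have : \prod_(C in D) sign sigma C = -1.
  rewrite (eq_bigr (fun=> -1)) ?prodr_const => [|C /(subsetP sD)/unb//].
  by rewrite -signr_odd oD.
rewrite /sign (exchange_big_dep predT) //= big1 // => e _.
have -> : \prod_(C in D | val e \in C) sigma e
        = sigma e ^+ #|[set C in D | val e \in C]|.
  by rewrite prodr_const; congr (_ ^+ _); apply: eq_card => C; rewrite inE.
have := dep _ (valP e); case: (sgn e) => -> ev; first by rewrite expr1n.
by rewrite -signr_odd (negPf ev).
Qed.

(* Linear independence of the incidence vectors makes every right-hand side of
   the system [sum of sigma over C = 1] solvable over F_2. *)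
Lemma independent_famA n G :
  (forall D, dependence n G D -> D = set0) -> famA n G.
Proof.
move=> indep; pose m := #|cycles n G|; pose r := #|{: edge G}|.
pose A : 'M['F_2]_(m, r) := \matrix_(i, j) chi G (enum_val i) (enum_val j).
have freeA : row_free A.
  apply: inj_row_free => v /rowP vA0.
  pose D := [set enum_val i | i : 'I_m & v 0 i != 0].
  have D0 : D = set0.
    apply: indep; split.
      by apply/subsetP => _ /imsetP[i _ ->]; apply: enum_valP.
    apply/ffunP => e; rewrite big_imset => [|i j _ _ /enum_val_inj//].
    have := vA0 (enum_rank e); rewrite !mxE => vAe.
    rewrite sum_ffunE [in RHS]ffunE -[RHS]vAe big_mkcond.
    apply: eq_bigr => i _; rewrite inE mxE enum_rankK [v 0 i]F2_bool.
    by case: (v 0 i == 0); rewrite ?mul0r ?mul1r.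
  apply/rowP => i; rewrite mxE; apply/eqP/idPn => vi.
  have : enum_val i \in D by apply: imset_f; rewrite inE.
  by rewrite D0 inE.
pose y : 'cV['F_2]_r := pinvmx A *m const_mx 1.
have Ay : A *m y = const_mx 1 by rewrite mulmxA mulmxVp // mul1mx.
pose z e : bool := y (enum_rank e) 0 != 0.
exists (fun e => (-1) ^+ z e); split=> [e|C CG].
  by case: (z e); [right|left].
rewrite /unbalanced /sign.
have -> : \prod_(e : edge G | val e \in C) (-1) ^+ z e
  = (-1) ^+ (\sum_(e : edge G | val e \in C) z e)%N :> int.
  by rewrite (big_morph _ (exprD _) (expr0 _)).
rewrite -signr_odd; suff -> : odd (\sum_(e : edge G | val e \in C) z e) by [].
apply/negPn; rewrite -natr_F2 natr_sum.
suff -> : \sum_(e : edge G | val e \in C) (z e)%:R = 1 :> 'F_2 by [].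
have := congr1 (fun B : 'cV__ => B (enum_rank_in CG C) 0) Ay.
rewrite !mxE => Ay1; rewrite -[RHS]Ay1 {Ay1}.
rewrite (reindex (@enum_rank (edge G))) /=; last first.
  by exists enum_val => i _; rewrite ?enum_rankK ?enum_valK.
rewrite big_mkcond; apply: eq_bigr => e _.
rewrite mxE enum_rankK enum_rankK_in // ffunE [y _ _]F2_bool -/(z e).
by case: ifP; rewrite ?mul1r ?mul0r.
Qed.

(** A nonzero dependence in a proper subgraph would also be one in [G], hence would consist of all
    [n]-cycles of [G]. These cover every edge and every vertex, so the subgraph would be [G] itself.
    Proper subgraphs thus have independent cycles and admit the signing. *)
Lemma unique_odd_dependence_famB n G :
  (forall D, (dependence n G D /\ D <> set0) <-> D = cycles n G) ->
  odd #|cycles n G| ->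
  (forall x, x \in verts G -> exists2 e, e \in edges G & x \in e) ->
  (forall e, e \in edges G -> exists2 C, C \in cycles n G & e \in C) ->
  famB n G.
Proof.
move=> dep oG vG eG; split.
  by apply: odd_dependence_not_famA oG; have [] := (dep (cycles n G)).2 erefl.
move=> H [[svH seH] HG]; apply: independent_famA => D depD.
apply/eqP/idPn => /eqP D0.
have DG : D = cycles n G by apply/dep; split=> //; apply: dependence_subgraph depD.
case: HG => [nvH|neH]; last first.
  apply: neH; apply/eqP; rewrite eqEsubset seH; apply/subsetP => e /eG[C CG eC].
  have [sDH _] := depD; rewrite -DG in CG.
  exact: subsetP (cycles_edges (subsetP sDH _ CG)) _ eC.
apply: nvH; apply/eqP; rewrite eqEsubset svH; apply/subsetP => x /vG[e /eG[C CG eC] xe].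
have [sDH _] := depD; rewrite -DG in CG.
have /edgesP[/subsetP-> //] := subsetP (cycles_edges (subsetP sDH _ CG)) _ eC.
Qed.

End SignedGraphs.

(** * Sums against indicators, and cyclic successors modulo [n] *)

Section CyclicOrdinals.
Set Implicit Arguments. Unset Strict Implicit. Unset Printing Implicit Defensive.

Lemma sum_delta (I : finType) (F : I -> nat) x : \sum_y F y * (y == x) = F x.
Proof.
rewrite (bigD1 x) //= eqxx muln1 big1 ?addn0 // => y /negPf->.
by rewrite muln0.
Qed.

Lemma leq_sum_term (I : finType) (F : I -> nat) x : F x <= \sum_y F y.
Proof. by rewrite (bigD1 x) //= leq_addr. Qed.

Lemma leq_sum_term2 (I : finType) (F : I -> nat) x y :
  x != y -> F x + F y <= \sum_z F z.
Proof.
move=> xy; rewrite (bigD1 x) //= leq_add2l (bigD1 y) /= ?leq_addr //.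
by rewrite eq_sym.
Qed.

Lemma val_ordS n (i : 'I_n) : val (ordS i) = if i.+1 == n then 0 else i.+1.
Proof.
rewrite /=; case: eqP => [->|ne]; first by rewrite modnn.
by rewrite modn_small // ltn_neqAle ltn_ord andbT; apply/eqP.
Qed.

Lemma ordS_neq n (i : 'I_n) : 1 < n -> ordS i != i.
Proof.
move=> n1; have := ltn_ord i.
by rewrite -val_eqE val_ordS; case: (i.+1 =P n) => /= ? ?; lia.
Qed.

Lemma ordS2_neq n (i : 'I_n) : 2 < n -> ordS (ordS i) != i.
Proof.
move=> n2; have := ltn_ord i; rewrite -val_eqE !val_ordS.
by case: (i.+1 =P n) => /= ?; case: (_.+1 =P n) => /= ? ?; lia.
Qed.

Lemma ord_pred_neq n (i : 'I_n) : 1 < n -> ord_pred i != i.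
Proof. by move=> n1; rewrite -(inj_eq (@ordS_inj n)) ord_predK eq_sym ordS_neq. Qed.

Lemma ord_pred_eq n (i j : 'I_n) : (ord_pred i == j) = (i == ordS j).
Proof. by rewrite -(inj_eq (@ordS_inj n)) ord_predK. Qed.

(** Cyclic steps reach every index from 0. This is how relations between neighbours are carried
    around the torus. *)
Lemma ord_pred_invariant n (T : Type) (P : 'I_n -> T) :
  (forall i, P (ord_pred i) = P i) -> forall i j, P i = P j.
Proof.
case: n P => [|n] P Pp; first by case.
suff P0 : forall m (lt_m : m < n.+1), P (Ordinal lt_m) = P ord0.
  by case=> m lm [m' lm']; rewrite !P0.
elim=> [|m IHm] lt_m; first by congr P; apply: val_inj.
rewrite -(IHm (ltnW lt_m)) -Pp; congr P; apply/eqP; rewrite ord_pred_eq.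
by rewrite -val_eqE val_ordS (ltn_eqF lt_m).
Qed.

End CyclicOrdinals.

(** * Small even edge sets in the toroidal grid *)

Section EvenGridSets.
Set Implicit Arguments. Unset Strict Implicit. Unset Printing Implicit Defensive.
Variable N : nat.

(* [h i j] selects the grid edge from (i, j) to (i + 1, j) and [v i j] the one
   from (i, j) to (i, j + 1), indices modulo [N]; the condition says that every
   vertex has even degree. *)
Definition even_grid (h v : 'I_N -> 'I_N -> bool) :=
  forall i j, h i j (+) h (ord_pred i) j (+) (v i j (+) v i (ord_pred j)) = false.

(** Reflection in the diagonal transfers each result on horizontal edges to vertical ones. *)
Lemma even_grid_swap h v :
  even_grid h v -> even_grid (fun j i => v i j) (fun j i => h i j).
Proof. by move=> ev j i; rewrite addbC; apply: ev. Qed.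

(* In the sum of the degree conditions at the vertices (i, 0), (i, 1), ... the
   vertical edges cancel: all columns of horizontal edges have the same parity,
   and this parity is even since some column is empty. *)
Lemma even_grid_column h v i : even_grid h v ->
  (\sum_i \sum_j h i j)%N < N -> ~~ odd (\sum_j h i j).
Proof.
move=> ev lt_hN; apply/negP => odd_i.
pose p i := \big[addb/false]_j h i j.
have pE i' : odd (\sum_j h i' j) = p i'.
  by rewrite (big_morph odd oddD (erefl : odd 0 = false)); under eq_bigr do rewrite oddb.
have p_pred i' : p (ord_pred i') = p i'.
  apply/eqP; rewrite eq_sym -[_ == _]negbK -negb_add -[p i' (+) _]big_split /=.
  under eq_bigr => j _ do rewrite -[_ (+) _]addbF -(ev i' j) addKb.
  rewrite big_split /= (reindex_inj (@ord_pred_inj N)) /= addbb //.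
have := lt_hN; rewrite ltnNge => /negP[].
rewrite -[N in N <= _]card_ord -sum1_card leq_sum // => i' _.
by apply: odd_gt0; rewrite pE (ord_pred_invariant p_pred i' i) -pE.
Qed.

(** Without horizontal edges the degree conditions make [v i] constant, so one vertical edge would
    bring along a closed line of [N] of them. *)
Lemma even_grid_nonempty h v i j : even_grid h v ->
  \sum_i \sum_j v i j < N -> v i j -> exists i' j', h i' j'.
Proof.
move=> ev lt_vN vij.
have [/existsP[i' /existsP[j' hij]]|/existsPn h0] := boolP [exists i', exists j', h i' j'].
  by exists i', j'.
have {}h0 i' j' : h i' j' = false by have /existsPn/(_ j')/negPf := h0 i'.
have v_pred j' : v i (ord_pred j') = v i j'.
  by have := ev i j'; rewrite !h0 /=; case: (v i j'); case: (v _ _).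
have := lt_vN; rewrite ltnNge => /negP[].
apply: leq_trans (leq_sum_term (fun i => \sum_j v i j) i).
rewrite -[N in N <= _]card_ord -sum1_card leq_sum // => j' _.
by rewrite (ord_pred_invariant v_pred j' j) vij.
Qed.

(** A nonempty column of parallel edges has even size, hence at least two edges; two nonempty
    columns would need at least four. *)
Lemma even_grid_unique h v i j : even_grid h v ->
  (\sum_i \sum_j h i j)%N < N -> h i j ->
  2 <= \sum_i \sum_j h i j
  /\ (\sum_i \sum_j h i j <= 2 -> forall i' j', h i' j' -> i' = i).
Proof.
move=> ev lt_hN hij.
have ge2 i' j' : h i' j' -> 2 <= \sum_j h i' j.
  move=> hij'; have := even_grid_column i' ev lt_hN.
  have := leq_sum_term (fun j => nat_of_bool (h i' j)) j'; rewrite hij' /=.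
  by case: (\sum_j _) => [|[]].
split=> [|le2 i' j' hij'].
  exact: leq_trans (ge2 _ _ hij) (leq_sum_term (fun i => \sum_j h i j) i).
apply/eqP/idPn => ii'.
have := leq_sum_term2 (fun i => \sum_j h i j) ii'.
by have := ge2 _ _ hij; have := ge2 _ _ hij'; lia.
Qed.

(** The weight [a.+1] is the length of a subdivided horizontal edge. Both directions occur, each at
    least twice, and two of each already exhaust the total [2 * a.+2]. So one column and one row
    carry everything, and the degree conditions fix the rest. *)
Lemma even_grid_face a h v : 2 * a.+2 < N -> even_grid h v ->
  a.+1 * \sum_i \sum_j h i j + \sum_i \sum_j v i j = 2 * a.+2 ->
  exists i0 j0,
    (forall i j, h i j = (i == i0) && ((j == j0) || (j == ordS j0))) /\
    (forall i j, v i j = (j == j0) && ((i == i0) || (i == ordS i0))).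
Proof.
move=> lt_aN ev sz; have evt := even_grid_swap ev.
have N1 : 1 < N by lia.
pose sh := \sum_i \sum_j h i j; pose sv := \sum_i \sum_j v i j.
have svE : sv = \sum_j \sum_i v i j by rewrite /sv exchange_big.
have lt_h : sh < N by rewrite /sh; nia.
have lt_v : sv < N by rewrite /sv; lia.
have lt_vt := lt_v; rewrite svE in lt_vt.
have lt_ht : \sum_j \sum_i h i j < N by rewrite exchange_big.
(* With no horizontal edge, any vertical edge forces one; with no edge at all, the total length
   would be 0. *)
have [i0 [j0 h0]] : exists i j, h i j.
  have [/existsP[i /existsP[j hij]]|/existsPn h0] := boolP [exists i, exists j, h i j].
    by exists i, j.
  have h00 : sh = 0.
    apply: big1 => i _; apply: big1 => j _.
    by have /existsPn/(_ j)/negPf-> := h0 i.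
  have [/existsP[i /existsP[j vij]]|/existsPn v0] := boolP [exists i, exists j, v i j].
    exact: (even_grid_nonempty ev lt_v vij).
  suff v00 : sv = 0 by move: sz; rewrite -/sh -/sv h00 v00; lia.
  apply: big1 => i _; apply: big1 => j _.
  by have /existsPn/(_ j)/negPf-> := v0 i.
have [j2 [i1 v1]] := even_grid_nonempty evt lt_ht h0.
have [ge_h uniq_h] := even_grid_unique ev lt_h h0.
have [] := even_grid_unique evt lt_vt v1; rewrite -svE => ge_v uniq_v.
have [le_h le_v] : sh <= 2 /\ sv <= 2.
  by move: sz ge_h ge_v; rewrite -/sh -/sv; clearbody sh sv; nia.
have {}uniq_h := uniq_h le_h; have {}uniq_v i j := uniq_v le_v j i.
have h_ne i j : i != i0 -> h i j = false by apply: contraNF => /uniq_h->.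
have v_ne i j : j != j2 -> v i j = false by apply: contraNF => /uniq_v->.
(* Otherwise no vertical edge starts at a vertex [(i0, j)], and the edge [h i0 j0] is alone at
   [(i0, j0)], which then has odd degree. *)
have v02 : v i0 j2.
  apply/negPn/negP => /negPf v02.
  have v0 j : v i0 j = false by have [->|/v_ne] := eqVneq j j2.
  by have := ev i0 j0; rewrite h0 !v0 h_ne // ord_pred_neq.
(* At [(i0, j)] the horizontal edge from the left is absent, so [h i0 j] is the parity of the
   vertical edges there, and [v i0 j2] is the only vertical edge in question. *)
have hE j : h i0 j = (j == j2) || (j == ordS j2).
  have := ev i0 j; rewrite [h (ord_pred _) _]h_ne ?ord_pred_neq //.
  have vE j' : v i0 j' = (j' == j2) by have [->|/v_ne] := eqVneq j' j2.
  rewrite !vE ord_pred_eq; have [->|_] := eqVneq j j2.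
    by rewrite eq_sym (negPf (ordS_neq _ N1)); case: (h _ _).
  by case: (h _ _); case: (_ == _).
have h02 : h i0 j2 by rewrite hE eqxx.
exists i0, j2; split=> i j.
  by have [->|/h_ne] := eqVneq i i0; rewrite ?hE.
have [->|/v_ne//] := eqVneq j j2.
have := ev i j2; rewrite [v _ (ord_pred _)]v_ne ?ord_pred_neq //.
have hE' i' : h i' j2 = (i' == i0) by have [->|/h_ne] := eqVneq i' i0.
rewrite !hE' ord_pred_eq /=; have [->|_] := eqVneq i i0.
  by rewrite eq_sym (negPf (ordS_neq _ N1)); case: (v _ _).
by case: (v _ _); case: (_ == _).
Qed.
End EvenGridSets.

(** * Closing two parallel paths into a cycle *)

Section PathComplements.
Set Implicit Arguments. Unset Strict Implicit. Unset Printing Implicit Defensive.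

Lemma path_traject (T : Type) (e : rel T) (f : T -> T) x n :
  (forall m, m < n -> e (iter m f x) (iter m.+1 f x)) ->
  path e x (traject f (f x) n).
Proof.
elim: n => // n IHn en; rewrite trajectSr rcons_path last_traject -iterSr en //.
by rewrite andbT; apply: IHn => m lt_mn; apply/en/ltnW.
Qed.

(** Meant for the boundary of a face: one horizontal side is traversed forwards, the other
    backwards, and two vertical edges link them. *)
Lemma cycle_cat_rev (T : Type) (e : rel T) x s y t : symmetric e ->
  path e x s -> path e y t -> e (last x s) (last y t) -> e y x ->
  cycle e ((x :: s) ++ rev (y :: t)).
Proof.
move=> esym xs yt last_st yx; rewrite (lastI y) rev_rcons /= rcons_cat cat_path xs /=.
rewrite last_st rcons_path rev_path (eq_path (e' := e)) => [|u w]; last exact: esym.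
suff -> : last (last y t) (rev (belast y t)) = y by rewrite yt.
by rewrite -[LHS]/(last y (_ :: rev (belast y t))) -rev_rcons -lastI rev_cons last_rcons.
Qed.

End PathComplements.

(** * The subdivided torus grid and its faces *)

Section SubdividedTorus.
Set Implicit Arguments. Unset Strict Implicit. Unset Printing Implicit Defensive.
Variables N a : nat.
Hypothesis lt_aN : 2 * a.+2 < N.

Let N1 : 1 < N. Proof. by lia. Qed.
Let N2 : 2 < N. Proof. by lia. Qed.

(* [(i, j, t)] with [t > 0] is the [t]-th inner vertex of the subdivided
   horizontal edge from [(i, j, 0)] to [(i + 1, j, 0)]. *)
Definition torus_vertex : finType := ('I_N * 'I_N * 'I_a.+1)%type.

(** The left summand indexes the horizontal edges by the vertex that they leave to the right; the
    right summand indexes the undivided vertical edges by their starting grid vertex. Incidences can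
    then be computed on indices, before edges become sets. *)
Definition torus_edge : finType := (torus_vertex + 'I_N * 'I_N)%type.

Definition right (x : torus_vertex) : torus_vertex :=
  let: (i, j, t) := x in (if t == ord_max then ordS i else i, j, ordS t).

Definition left (x : torus_vertex) : torus_vertex :=
  let: (i, j, t) := x in (if t == ord0 then ord_pred i else i, j, ord_pred t).

Definition src (e : torus_edge) : torus_vertex :=
  match e with inl x => x | inr p => (p, ord0) end.

Definition tgt (e : torus_edge) : torus_vertex :=
  match e with inl x => right x | inr (i, j) => (i, ordS j, ord0) end.

Definition ends (e : torus_edge) : {set torus_vertex} := [set src e; tgt e].

(** The first two coordinates of a face index are its corner. All [t] are allowed, so the boundary
    has two whole segments and two vertical edges, [2 * a.+1 + 2] edges in all. *)
Definition in_face (p : 'I_N * 'I_N) (e : torus_edge) : bool :=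
  match e with
  | inl (i, j, t) => (i == p.1) && ((j == p.2) || (j == ordS p.2))
  | inr (i, j) => (j == p.2) && ((i == p.1) || (i == ordS p.1))
  end.

Definition face (p : 'I_N * 'I_N) : {set {set torus_vertex}} :=
  [set ends e | e : torus_edge & in_face p e].

Lemma ordS_max_eq0 n (t : 'I_n.+1) : (ordS t == ord0) = (t == ord_max).
Proof.
rewrite -!val_eqE val_ordS /= eqSS; have := ltn_ord t.
by case: (val t == n).
Qed.

Lemma rightK : cancel right left.
Proof.
move=> [[i j] t]; rewrite /left /right ordS_max_eq0 ordSK.
by case: (t == ord_max); rewrite ?ordSK.
Qed.

Lemma leftK : cancel left right.
Proof.
move=> [[i j] t]; rewrite /left /right ord_predK -ordS_max_eq0 ord_predK.
by case: (t == ord0); rewrite ?ord_predK.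
Qed.

Lemma right_neq x : right x != x.
Proof.
case: x => [[i j] t]; rewrite /right !xpair_eqE; case: (t =P ord_max) => [->|tmax].
  by rewrite (negPf (ordS_neq i N1)).
rewrite !eqxx /= -val_eqE val_ordS eqSS.
have -> : (val t == a) = false by apply/eqP => e; apply/tmax/val_inj.
by rewrite gtn_eqF.
Qed.

(** Horizontal circles are longer than 2, which excludes double edges in [ends_inj]. *)
Lemma right2_neq x : right (right x) != x.
Proof.
case: x => [[i j] t]; rewrite /right !xpair_eqE.
case: (t =P ord_max) => [->|tmax].
  case: ifP => _; first by rewrite (negPf (ordS2_neq i N2)).
  by rewrite (negPf (ordS_neq i N1)).
have lt_ta : t < a.
  by rewrite ltn_neqAle -ltnS ltn_ord andbT; apply/eqP => e; apply/tmax/val_inj.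
case: (ordS t =P ord_max) => [_|Stmax]; first by rewrite (negPf (ordS_neq i N1)).
have vt : val (ordS t) = t.+1 by rewrite val_ordS ltn_eqF.
rewrite -[_ == t]val_eqE val_ordS vt; case: (t.+2 =P a.+1) => [e|_].
  by case: Stmax; apply: val_inj; rewrite vt; apply: eq_add_S e.
by rewrite gtn_eqF ?andbF.
Qed.

Lemma src_neq_tgt e : src e != tgt e.
Proof.
case: e => [x|[i j]] /=; first by rewrite eq_sym right_neq.
by rewrite !xpair_eqE (eq_sym j) (negPf (ordS_neq j N1)) andbF.
Qed.

Lemma ends_inl_row x y : y \in ends (inl x) -> y.1.2 = x.1.2.
Proof. by case: x => [[i j] t]; rewrite !inE => /orP[/eqP->|/eqP->]. Qed.

(** A horizontal edge stays in its row, a vertical one changes row. *)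
Lemma ends_inl_inr x p : ends (inl x) != ends (inr p).
Proof.
case: p => [i j]; apply/eqP => /setP xp; have := ordS_neq j N1.
have /= -> : (i, ordS j, @ord0 a).1.2 = x.1.2.
  by apply: ends_inl_row; rewrite xp !inE eqxx orbT.
have /= -> : (i, j, @ord0 a).1.2 = x.1.2.
  by apply: ends_inl_row; rewrite xp !inE eqxx.
by rewrite eqxx.
Qed.

Lemma ends_inj : injective ends.
Proof.
case=> [x|p] [y|q] e; last 1 first.
- case: p q e => [i j] [i' j'] /setP e.
  have := e (i', j', ord0); have := e (i, j, ord0).
  rewrite !inE !eqxx !xpair_eqE !eqxx !andbT /= => /esym/orP[|] /andP[/eqP-> /eqP->] //.
  rewrite !eqxx [j' == ordS j']eq_sym [j' == _]eq_sym.
  by rewrite (negPf (ordS_neq j' N1)) (negPf (ordS2_neq j' N2)).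
- have /setP xy := e; have := xy x; have := xy y.
  rewrite !inE !eqxx /= => xy' /esym/orP[/eqP->//|/eqP xy2]; move: xy'.
  rewrite xy2 [y == right y]eq_sym [y == _]eq_sym.
  by rewrite (negPf (right_neq y)) (negPf (right2_neq y)).
- by have := ends_inl_inr x q; rewrite e eqxx.
- by have := ends_inl_inr y p; rewrite e eqxx.
Qed.

Lemma mem_face p e : (ends e \in face p) = in_face p e.
Proof. by rewrite mem_imset ?inE //; apply: ends_inj. Qed.

Lemma torus_edgesP (c : {set torus_vertex}) : c \in ends @: setT ->
  (c \subset [set: torus_vertex]) /\ #|c| = 2.
Proof. by case/imsetP=> e _ ->; rewrite subsetT cards2 src_neq_tgt. Qed.

Definition torus : graph torus_vertex := Graph torus_edgesP.

Lemma ends_edge e : ends e \in edges torus.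
Proof. exact: imset_f. Qed.

Lemma face_sub_torus p : face p \subset edges torus.
Proof. by apply/subsetP => _ /imsetP[e _ ->]; apply: ends_edge. Qed.

(** The two vertical sides suffice: as [N] exceeds 2, a pair of cyclically consecutive columns
    determines which of them comes first. *)
Lemma face_subset p q : face p \subset face q -> p = q.
Proof.
move=> /subsetP pq; have inf e : in_face p e -> in_face q e.
  by rewrite -!mem_face => /pq.
have := inf (inr p); have := inf (inr (ordS p.1, p.2)).
case: p q {inf pq} => [i j] [i' j'] /=; rewrite !eqxx ?orbT.
move=> /(_ isT)/andP[/eqP-> i1] /(_ isT)/andP[_ i2]; congr pair; apply/eqP.
case/orP: i2 i1 => [/eqP->|/eqP->]; rewrite ?eqxx //.
by rewrite (negPf (ordS2_neq _ N2)) (inj_eq (@ordS_inj N)).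
Qed.

Lemma face_inj : injective face.
Proof. by move=> p q pq; apply: face_subset; rewrite pq. Qed.

(** * Every cycle of length [2 * a.+2] is a face *)

Lemma card_torus_edges (C : {set {set torus_vertex}}) (P : pred {set torus_vertex}) :
  C \subset edges torus ->
  #|[set c in C | P c]| = \sum_e ((ends e \in C) && P (ends e)).
Proof.
move=> sC; have -> : [set c in C | P c] =
    ends @: [set e | (ends e \in C) && P (ends e)].
  apply/setP => c; rewrite inE; apply/andP/imsetP => [[cC Pc]|[e]].
    by have /imsetP[e _ ce] := subsetP sC _ cC; exists e; rewrite // inE -ce cC.
  by rewrite inE => /andP[eC Pe] ->.
rewrite card_imset; last exact: ends_inj.
rewrite -sum1_card big_mkcond; apply: eq_bigr => e _.
by rewrite inE; case: (_ && _).
Qed.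

(** Every vertex meets two horizontal edges; vertical edges meet only the grid vertices, those with
    [t = ord0]. *)
Lemma torus_even (C : {set {set torus_vertex}}) i j t : C \subset edges torus ->
  ~~ odd #|[set c in C | (i, j, t) \in c]| ->
  (ends (inl (i, j, t)) \in C) (+) (ends (inl (left (i, j, t))) \in C) (+)
  (t == ord0) && ((ends (inr (i, j)) \in C) (+) (ends (inr (i, ord_pred j)) \in C))
  = false.
Proof.
move=> sC; set x := (i, j, t); set y := left x; rewrite card_torus_edges //.
(* There are no loops, so the degree splits into a sum over sources and a sum over targets, each
   evaluated by [sum_delta]. *)
have memE e : x \in ends e = (src e == x) + (tgt e == x) :> nat.
  rewrite !inE ![x == _]eq_sym; have [<-|//] := eqVneq (src e) x.
  by rewrite eq_sym (negPf (src_neq_tgt e)).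
have andE e : (ends e \in C) && (x \in ends e) =
    (ends e \in C) * (src e == x) + (ends e \in C) * (tgt e == x) :> nat.
  by rewrite -mulnDr -memE; case: (ends e \in C); rewrite ?mul1n.
under eq_bigr do rewrite andE.
rewrite big_split /= !big_sumType [src]lock [tgt]lock /= -!lock sum_delta.
under [\sum_(z : torus_vertex) _]eq_bigr => z _ do
  rewrite [tgt _ == x](can2_eq rightK leftK) -/y.
rewrite sum_delta.
have srcE p : (src (inr p) == x) = (p == (i, j)) && (t == ord0).
  by rewrite xpair_eqE [ord0 == _]eq_sym.
have tgtE p : (tgt (inr p) == x) = (p == (i, ord_pred j)) && (t == ord0).
  case: p => i' j'; rewrite !xpair_eqE [ord0 == _]eq_sym.
  by rewrite -(inj_eq (@ordS_inj N) j') ord_predK.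
case: (t == ord0) srcE tgtE => srcE tgtE; last first.
  rewrite [\sum_(p : _ * _) _ * (src _ == x)]big1 => [|p _]; last first.
    by rewrite srcE andbF muln0.
  rewrite [\sum_(p : _ * _) _ * (tgt _ == x)]big1 => [|p _]; last first.
    by rewrite tgtE andbF muln0.
  by rewrite !addn0 oddD !oddb andFb addbF => /negPf.
under [\sum_(p : _ * _) _ * (src _ == x)]eq_bigr do rewrite srcE andbT.
under [\sum_(p : _ * _) _ * (tgt _ == x)]eq_bigr do rewrite tgtE andbT.
rewrite !sum_delta !oddD !oddb => /negPf <-.
by rewrite -!addbA; congr (_ (+) _); rewrite addbCA.
Qed.

Lemma torus_cycles_face C : C \in cycles (2 * a.+2) torus -> exists p, C = face p.
Proof.
move=> CT; have sC := cycles_edges CT.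
have gt2 : 2 < 2 * a.+2 by lia.
have even_at i j t := torus_even sC (cycles_even (i, j, t) gt2 CT).
pose h i j := ends (inl (i, j, ord0)) \in C; pose v i j := ends (inr (i, j)) \in C.
(* An inner vertex lies on just two edges, so even degree makes [C] contain both or neither; hence
   it contains a segment wholly or not at all. *)
have hE i j t : (ends (inl (i, j, t)) \in C) = h i j.
  case: t => m lt_m; elim: m lt_m => [|m IHm] lt_m.
    by rewrite /h; congr (ends (inl (_, _)) \in C); apply: val_inj.
  rewrite -(IHm (ltnW lt_m)); have := even_at i j (Ordinal lt_m).
  have -> : left (i, j, Ordinal lt_m) = (i, j, Ordinal (ltnW lt_m)).
    rewrite /left /=; congr (_, _); apply/eqP; rewrite ord_pred_eq -val_eqE val_ordS.
    by rewrite (ltn_eqF lt_m).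
  by rewrite andFb addbF; do 2!case: (_ \in C).
have ev : even_grid h v.
  by move=> i j; have := even_at i j ord0; rewrite /left eqxx !hE.
(* The side condition is the length count, in which each selected segment contributes [a.+1]
   edges. *)
have [|i [j [hF vF]]] := even_grid_face lt_aN ev.
  rewrite -(card_cycles_edges gt2 CT).
  have -> : C = [set c in C | predT c] by apply/setP => c; rewrite inE andbT.
  rewrite card_torus_edges // big_sumType /=; congr (_ + _).
    rewrite pair_bigA big_distrr /=.
    transitivity (\sum_p \sum_(t : 'I_a.+1) (ends (inl (p, t)) \in C)).
      apply: eq_bigr => -[i j] _; under eq_bigr do rewrite hE.
      by rewrite sum_nat_const card_ord.
    by rewrite pair_bigA; apply: eq_bigr => -[p t] _; rewrite andbT.
  by rewrite pair_bigA; apply: eq_bigr => -[i j] _; rewrite andbT.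
have CE e : (ends e \in C) = in_face (i, j) e.
  by case: e => [[[i' j'] t]|[i' j']] /=; [rewrite hE hF | rewrite -vF].
exists (i, j); apply/setP => c; apply/idP/idP => [cC|/imsetP[e]].
  have /imsetP[e _ ce] := subsetP sC _ cC.
  by rewrite ce mem_face -CE -ce.
by rewrite inE -CE => eC ->.
Qed.

(** * Every face is a cycle of length [2 * a.+2] *)

Lemma iter_right i j m : m <= a ->
  iter m right (i, j, ord0) = (i, j, inord m).
Proof.
elim: m => [|m IHm] lt_ma.
  by congr (_, _); apply: val_inj; rewrite /= inordK.
rewrite iterS IHm 1?ltnW // /right.
have -> : (inord m == ord_max :> 'I_a.+1) = false.
  by rewrite -val_eqE /= inordK 1?ltnW // ltn_eqF.
congr (_, _); apply: val_inj; rewrite val_ordS !inordK 1?ltnW //.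
by rewrite eqSS ltn_eqF //= inordK.
Qed.

Lemma iter_right_segment i j : iter a.+1 right (i, j, ord0) = (ordS i, j, ord0).
Proof.
rewrite iterS iter_right // /right.
have -> : inord a = ord_max :> 'I_a.+1 by apply: val_inj; rewrite /= inordK.
by rewrite eqxx; congr (_, _); apply: val_inj; rewrite val_ordS eqxx.
Qed.

(** A segment of [a.+1] edges has [a.+2] vertices, both grid ends included. *)
Definition face_row i j : seq torus_vertex := traject right (i, j, ord0) a.+2.

(** A repetition along an orbit would make the last vertex equal to an earlier one, but only the
    last has first coordinate [ordS i]. *)
Lemma uniq_face_row i j : uniq (face_row i j).
Proof.
rewrite /face_row looping_uniq /looping iter_right_segment.
apply/trajectP => -[m lt_ma]; rewrite iter_right // => -[/eqP].
by rewrite (negPf (ordS_neq i N1)).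
Qed.

Lemma face_row_row i j x : x \in face_row i j -> x.1.2 = j.
Proof.
case/trajectP => m; rewrite ltnS leq_eqVlt => /orP[/eqP->|lt_m] ->.
  by rewrite iter_right_segment.
by rewrite iter_right.
Qed.

Lemma face_cycle p : face p \in cycles (2 * a.+2) torus.
Proof.
case: p => i j; pose s := face_row i j ++ rev (face_row i (ordS j)).
have us : uniq s.
  rewrite cat_uniq rev_uniq !uniq_face_row andbT /=.
  apply/hasPn => x; rewrite mem_rev => /face_row_row xj'.
  apply/negP => /face_row_row xj; have := ordS_neq j N1.
  by rewrite -xj' -xj eqxx.
have sz : size s = 2 * a.+2.
  by rewrite size_cat size_rev !size_traject addnn mul2n.
pose e : rel torus_vertex := fun x y => [set x; y] \in face (i, j).
have e_ends f : in_face (i, j) f -> e (src f) (tgt f) by rewrite -mem_face.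
have esym x y : e x y = e y x by rewrite /e setUC.
have row j' : (j' == j) || (j' == ordS j) ->
    path e (i, j', ord0) (traject right (right (i, j', ord0)) a.+1).
  move=> jj'; apply: path_traject => m lt_ma; rewrite iterS iter_right //.
  by apply: (e_ends (inl _)); rewrite /= eqxx jj'.
have lastE j' : last (i, j', ord0) (traject right (right (i, j', ord0)) a.+1)
    = (ordS i, j', ord0).
  by rewrite last_traject iter_right_segment.
have cs : cycle e s.
  apply: cycle_cat_rev; rewrite ?lastE //; try by apply: row; rewrite eqxx ?orbT.
    by apply: (e_ends (inr (ordS i, j))); rewrite /= !eqxx orbT.
  by rewrite esym; apply: (e_ends (inr (i, j))); rewrite /= !eqxx.
have sub_s := cycle_edges_sub us cs.
(* So far the traced cycle is only known to lie inside the face. Being a cycle of the right length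
   it is itself a face, and inclusion between faces is equality. *)
have sT : cycle_edges s \in cycles (2 * a.+2) torus.
  apply/cyclesP; exists s; split=> //; apply: sub_cycle cs => x y.
  exact: (subsetP (face_sub_torus _)).
have [q sq] := torus_cycles_face sT.
by rewrite -(@face_subset q (i, j)) -sq.
Qed.

Lemma torus_cyclesE : cycles (2 * a.+2) torus = face @: setT.
Proof.
apply/setP => C; apply/idP/imsetP => [/torus_cycles_face[p ->]|[p _ ->]].
  by exists p.
exact: face_cycle.
Qed.

Lemma card_torus_cycles : #|cycles (2 * a.+2) torus| = N * N.
Proof.
rewrite torus_cyclesE card_imset; last exact: face_inj.
by rewrite cardsT card_prod card_ord.
Qed.

(** * Dependences among the faces *)

Lemma torus_count (D : {set {set {set torus_vertex}}}) e :
  D \subset cycles (2 * a.+2) torus ->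
  #|[set C in D | ends e \in C]| = \sum_p (face p \in D) * in_face p e.
Proof.
move=> sD; have -> : [set C in D | ends e \in C] =
    face @: [set p | (face p \in D) && in_face p e].
  apply/setP => C; rewrite inE; apply/andP/imsetP => [[CD eC]|[p]].
    have /torus_cycles_face[p Cp] := subsetP sD _ CD.
    by exists p; rewrite // inE -mem_face -Cp CD.
  by rewrite inE => /andP[pD pe] ->; rewrite mem_face.
rewrite card_imset; last exact: face_inj.
rewrite -sum1_card big_mkcond; apply: eq_bigr => p _.
by rewrite inE; case: (_ \in D); case: in_face.
Qed.

Lemma torus_count_inl (D : {set {set {set torus_vertex}}}) i j t :
  D \subset cycles (2 * a.+2) torus ->
  #|[set C in D | ends (inl (i, j, t)) \in C]| =
  (face (i, j) \in D) + (face (i, ord_pred j) \in D).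
Proof.
move=> sD; rewrite torus_count //.
rewrite -(sum_delta (fun p => face p \in D : nat) (i, j)).
rewrite -(sum_delta (fun p => face p \in D : nat) (i, ord_pred j)) -big_split /=.
apply: eq_bigr => -[i' j'] _; rewrite -mulnDr !xpair_eqE /=; congr (_ * _).
rewrite [i == _]eq_sym [j == j']eq_sym -ord_pred_eq [ord_pred j == _]eq_sym.
case: (i' == i) => //=; have [->|_] := eqVneq j' j; last by case: (_ == _).
by rewrite eq_sym (negPf (ord_pred_neq _ N1)).
Qed.

Lemma torus_count_inr (D : {set {set {set torus_vertex}}}) i j :
  D \subset cycles (2 * a.+2) torus ->
  #|[set C in D | ends (inr (i, j)) \in C]| =
  (face (i, j) \in D) + (face (ord_pred i, j) \in D).
Proof.
move=> sD; rewrite torus_count //.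
rewrite -(sum_delta (fun p => face p \in D : nat) (i, j)).
rewrite -(sum_delta (fun p => face p \in D : nat) (ord_pred i, j)) -big_split /=.
apply: eq_bigr => -[i' j'] _; rewrite -mulnDr !xpair_eqE /=; congr (_ * _).
rewrite [j == _]eq_sym [i == i']eq_sym -ord_pred_eq [ord_pred i == _]eq_sym.
case: (j' == j); rewrite ?andbF ?andbT //=.
have [->|_] := eqVneq i' i; last by case: (_ == _).
by rewrite eq_sym (negPf (ord_pred_neq _ N1)).
Qed.

(** Of the two faces at an edge, a dependence contains both or neither. Crossing horizontal and
    vertical edges in turn leads from one member to every face. *)
Lemma torus_dependence (D : {set {set {set torus_vertex}}}) :
  (dependence (2 * a.+2) torus D /\ D <> set0) <-> D = cycles (2 * a.+2) torus.
Proof.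
split=> [[/dependenceE[sD dep] D0]|->].
  have dh i j : (face (i, ord_pred j) \in D) = (face (i, j) \in D).
    have := dep _ (ends_edge (inl (i, j, ord0))).
    by rewrite torus_count_inl //; do 2!case: (_ \in D).
  have dv i j : (face (ord_pred i, j) \in D) = (face (i, j) \in D).
    have := dep _ (ends_edge (inr (i, j))).
    by rewrite torus_count_inr //; do 2!case: (_ \in D).
  apply/eqP; rewrite eqEsubset sD; apply/subsetP => _ /torus_cycles_face[[i j] ->].
  have /set0Pn[C CD] : D != set0 by apply/eqP.
  have /torus_cycles_face[[i' j'] Cp] := subsetP sD _ CD.
  rewrite (ord_pred_invariant (P := fun i => face (i, j) \in D) (dv^~ j) i i').
  by rewrite (ord_pred_invariant (dh i') j j') -Cp.
split; last first.
  by apply/eqP; rewrite -card_gt0 card_torus_cycles muln_gt0 (ltnW N1).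
apply/dependenceE; split=> // _ /imsetP[[[[i j] t]|[i j]] _ ->].
  by rewrite torus_count_inl // !face_cycle.
by rewrite torus_count_inr // !face_cycle.
Qed.

Lemma torus_famB : odd N -> famB (2 * a.+2) torus.
Proof.
move=> oddN; apply: unique_odd_dependence_famB.
- exact: torus_dependence.
- by rewrite card_torus_cycles oddM oddN.
- by move=> x _; exists (ends (inl x)); [apply: ends_edge | rewrite !inE eqxx].
- move=> _ /imsetP[[[[i j] t]|[i j]] _ ->]; exists (face (i, j));
    by rewrite ?face_cycle // mem_face /= !eqxx.
Qed.

End SubdividedTorus.

Theorem theorem2p4 (k : nat) (hk : 2 <= k) (L : nat) (hL : 0 < L) :
  exists (U : finType) (T : graph U),
    [/\ ~ famA (2 * k) T,
        forall D : {set {set {set U}}},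
          (dependence (2 * k) T D /\ D <> set0) <-> D = cycles (2 * k) T,
        odd #|cycles (2 * k) T| /\ L < #|cycles (2 * k) T|,
        forall H : graph U, proper_subgraph H T -> famA (2 * k) H
      & famB (2 * k) T].
Proof.
(* With [k = a.+2], this [N] is odd and exceeds both the cycle length [2 * a.+2] and [L], so [N * N]
   is odd and exceeds [L]. *)
case: k hk => [|[|a]] // _; pose N := (a.+2 + L).*2.+1.
have lt_aN : 2 * a.+2 < N by rewrite /N; lia.
have oddN : odd N by rewrite /= odd_double.
have lt_LN : L < N by rewrite /N; lia.
have BT := torus_famB lt_aN oddN; have [notA minT] := BT.
exists (torus_vertex N a), (torus lt_aN); split=> //.
  exact: torus_dependence.
rewrite card_torus_cycles oddM oddN; split=> //.
by apply: leq_trans lt_LN _; rewrite leq_pmulr.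
Qed.
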